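(* Let $T>0$ and let $(d(t),\,t\in[0,T])$ be a nonnegative, integrable, weakly increasing demand function. Suppose all stores are full at time $0$, i.e. $E_i(0)=\overline E_i$ for all $i\in\mathcal S$, and that some cross-charging policy, with store levels $(E_i(t))$, completely serves $d$ on $[0,T]$. Then there is a policy without cross-charging (all $r_i(t)\ge0$), with store levels $(\hat E_i(t))$, that completely serves $d$ on $[0,T]$ and satisfies $\hat E_i(T)\ge E_i(T)$ for every $i\in\mathcal S$.
   Context: A finite set $\mathcal S$ of energy stores is given. Store $i\in\mathcal S$ has capacity $\overline E_i>0$, maximum discharge rate $P_i>0$, maximum charge rate $P'_i\ge0$ and round-trip efficiency $\eta_i\in(0,1]$. A cross-charging policy is a choice of measurable rate functions $(r_i(t),\,t\ge0)$ with $E_i(t)=E_i(0)-\int_0^t r_i(u)\,du$, subject to $0\le E_i(t)\le\overline E_i$, $-P'_i\le r_i(t)\le P_i$, and $$0\le\sum_{i:\,r_i(t)\ge0}r_i(t)+\sum_{i:\,r_i(t)<0}r_i(t)/\eta_i\le d(t)\quad\text{for all }t$$ (negative $r_i$ means store $i$ is charged, drawing energy at rate $-r_i/\eta_i$ from other stores; no external energy is available). It completely serves $d$ on an interval $I$ if the middle expression equals $d(t)$ for almost every $t\in I$. A policy with all $r_i(t)\ge0$ is one without cross-charging. *)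

(* Defs.v *)
From HB Require Import structures.
From mathcomp Require Import all_boot all_order all_algebra.
From mathcomp Require Import all_classical all_reals all_analysis.
Set Implicit Arguments. Unset Strict Implicit. Unset Printing Implicit Defensive.
Import Order.TTheory GRing.Theory Num.Theory.
Local Open Scope classical_set_scope.
Local Open Scope ring_scope.

Definition level (R : realType) (E0 : R) (r : R -> R) (t : R) : R :=
  E0 - Rintegral (@lebesgue_measure R) `[0%R, t] r.

Definition served (R : realType) (S : finType) (eta : S -> R)
  (r : S -> R -> R) (t : R) : R :=
  \sum_(i : S) (if 0 <= r i t then r i t else r i t / eta i).

Definition is_policy (R : realType) (S : finType)
  (Ebar P P' eta : S -> R) (T : R) (d : R -> R) (E0 : S -> R)
  (r : S -> R -> R) : Prop :=
  (forall i, measurable_fun setT (r i)) /\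
  (forall t, 0 <= t <= T ->
     (forall i, 0 <= level (E0 i) (r i) t <= Ebar i) /\
     (forall i, - P' i <= r i t <= P i) /\
     0 <= served eta r t <= d t).

Definition completely_serves (R : realType) (S : finType) (eta : S -> R)
  (T : R) (d : R -> R) (r : S -> R -> R) : Prop :=
  {ae (@lebesgue_measure R), forall t, 0 <= t <= T -> served eta r t = d t}.

(* Main.v *)
(** The energies [e i] that the given policy takes from the stores over [0, T]
    dominate a feasible allocation without charging iff, for every set [A] of
    stores with total power [P A], the excess demand [int (d - P A)^+] is at most
    the sum of [e i] over the stores outside [A].

    Necessity (which holds even with cross-charging): as [d] increases, it
    exceeds [P A] on a final interval [(tau, T]].  There the stores outside [A]
    must deliver [d - P A], and they deliver at most [e i] each after [tau],
    since a store which starts full has nonnegative net output on [0, tau].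

    Sufficiency, by induction on the stores: the first store serves the layer
    [min (d - c)^+ P1] of the demand, with [c] chosen by the intermediate value
    theorem so that this uses exactly [e1] (or [c = 0] if even the bottom layer
    needs less than [e1]).  The conditions for the other stores and the remaining
    demand are inherited: when [P A >= c] from the condition for [A] with the
    first store added, when [P A < c] from the condition for [A] itself. *)
Require Import Defs.
From HB Require Import structures.
From mathcomp Require Import all_boot all_order all_algebra.
From mathcomp Require Import all_classical all_reals all_analysis.
From mathcomp Require Import measurable_realfun lra.
Import Order.TTheory GRing.Theory Num.Theory.
Import numFieldNormedType.Exports.
Local Open Scope classical_set_scope.
Local Open Scope ring_scope.

(** Nested [min] and [max] are split from the inside out, so that every comparison split on is
    between linear terms and [lra] can close each branch. *)
Local Ltac case_innermost a b :=
  lazymatch a with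
  | context [Order.max _ _] => fail
  | context [Order.min _ _] => fail
  | _ => case: (leP a b) => ?
  end.
Local Ltac minmax_lra :=
  repeat match goal with
  | |- context [Order.max ?a ?b] => case_innermost a b
  | |- context [Order.min ?a ?b] => case_innermost a b
  end; lra.

(** * Real-valued integrals: domination, finite sums, almost-everywhere comparison *)

Section Integration.
Context {dX : measure_display} {X : measurableType dX} {R : realType}.
Variables (mu : {measure set X -> \bar R}) (E : set X).
Hypothesis mE : measurable E.

Lemma le_normr_integrable (f g : X -> R) :
  measurable_fun E f -> mu.-integrable E (EFin \o g) ->
  (forall x, E x -> `|f x| <= `|g x|) -> mu.-integrable E (EFin \o f).
Proof.
move=> mf ig fg; apply: le_integrable ig => //; exact/measurable_EFinP.
Qed.

Lemma bounded_integrable (f : X -> R) (M : R) :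
  (mu E < +oo)%E -> measurable_fun E f -> (forall x, E x -> `|f x| <= M) ->
  mu.-integrable E (EFin \o f).
Proof.
move=> muE mf fM; apply: measurable_bounded_integrable => //.
exists M; split; first exact: num_real.
by move=> y My x Ex; exact: le_trans (fM x Ex) (ltW My).
Qed.

Lemma Rintegral_sum (I : Type) (s : seq I) (A : pred I) (f : I -> X -> R) :
  (forall i, mu.-integrable E (EFin \o f i)) ->
  \int[mu]_(x in E) (\sum_(i <- s | A i) f i x) =
  \sum_(i <- s | A i) \int[mu]_(x in E) f i x.
Proof.
move=> fi; rewrite /Rintegral sum_fine; last first.
  by move=> i _; exact: (integrable_fin_num mE (fi i)).
rewrite -(integral_sum mE fi); congr fine; apply: eq_integral => x _.
by rewrite sumEFin.
Qed.

Lemma integrable_sum_EFin (I : Type) (s : seq I) (A : pred I) (f : I -> X -> R) :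
  (forall i, mu.-integrable E (EFin \o f i)) ->
  mu.-integrable E (EFin \o (fun x => \sum_(i <- s | A i) f i x)).
Proof.
move=> fi; have -> : EFin \o (fun x => \sum_(i <- s | A i) f i x) =
    (fun x => \sum_(i <- s | A i) (EFin \o f i) x)%E.
  by apply/funext => x /=; rewrite sumEFin.
exact: integrable_sum.
Qed.

(** Replacing [g] by [f \max g], which equals it almost everywhere, reduces the claim to a pointwise
    inequality. *)
Lemma ae_le_Rintegral (f g : X -> R) :
  mu.-integrable E (EFin \o f) -> mu.-integrable E (EFin \o g) ->
  {ae mu, forall x, E x -> f x <= g x} ->
  \int[mu]_(x in E) f x <= \int[mu]_(x in E) g x.
Proof.
move=> fi gi fg.
have mf : measurable_fun E f by apply/measurable_EFinP; case/integrableP : fi.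
have mg : measurable_fun E g by apply/measurable_EFinP; case/integrableP : gi.
have mfg : measurable_fun E (f \max g) by exact: measurable_maxr.
have -> : \int[mu]_(x in E) g x = \int[mu]_(x in E) (f \max g) x.
  congr fine; apply: ae_eq_integral => //; try exact/measurable_EFinP.
  by apply: filterS fg => x /[swap] Ex /(_ Ex) /max_r /= ->.
apply: le_Rintegral => //.
  apply: (@le_normr_integrable _ (fun x => `|f x| + `|g x|)) => //.
    rewrite (_ : EFin \o _ = ((abse \o (EFin \o f)) \+ (abse \o (EFin \o g)))%E)//.
    by apply: integrableD => //; exact: integrable_abse.
  move=> x _; rewrite [leRHS]ger0_norm ?addr_ge0//=.
  by rewrite maxEle; case: ifP => _; rewrite ?lerDl ?lerDr.
by move=> x _ /=; rewrite le_max lexx.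
Qed.

Lemma Rintegral0_ae (f : X -> R) :
  mu.-integrable E (EFin \o f) -> (forall x, E x -> 0 <= f x) ->
  \int[mu]_(x in E) f x <= 0 -> {ae mu, forall x, E x -> f x = 0}.
Proof.
move=> fi f0 If.
have mf : measurable_fun E (EFin \o f) by case/integrableP : fi.
have /(ae_eq_integral_abs mu mE mf) : (\int[mu]_(x in E) `|(EFin \o f) x| = 0)%E.
  transitivity (\int[mu]_(x in E) (EFin \o f) x)%E.
    by apply: eq_integral => x /set_mem Ex; rewrite /= ger0_norm// f0.
  rewrite -[LHS]fineK; last exact: integrable_fin_num.
  congr EFin; apply/eqP; rewrite eq_le If/=.
  exact: Rintegral_ge0.
by apply: filterS => x /[apply] -[].
Qed.

End Integration.

(** * Sufficiency: peeling horizontal layers off the demand *)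

Section Allocation.
Context {dX : measure_display} {X : measurableType dX} {R : realType}.
Variables (mu : {measure set X -> \bar R}) (E : set X).
Hypotheses (mE : measurable E) (muE : (mu E < +oo)%E).

(** The slice of [D] between the heights [c] and [c + p]. *)
Let layer (D : X -> R) (p c : R) (x : X) : R :=
  Num.min (Num.max (D x - c) 0) p.

Let measurable_layer (D : X -> R) (p c : R) :
  measurable_fun setT D -> measurable_fun setT (layer D p c).
Proof.
move=> mD; apply: measurable_minr => //; apply: measurable_maxr => //.
exact: measurable_funB.
Qed.

Let layer_itv (D : X -> R) (p c : R) (x : X) : 0 <= p -> 0 <= layer D p c x <= p.
Proof. by rewrite /layer => ?; minmax_lra. Qed.

Let integrable_layer (D : X -> R) (p c : R) : 0 <= p -> measurable_fun setT D ->
  mu.-integrable E (EFin \o layer D p c).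
Proof.
move=> p0 mD; apply: (bounded_integrable _ _ mE _ p) => //.
  exact/measurable_funTS/measurable_layer.
by move=> x _; case/andP: (layer_itv D p c x p0) => *; rewrite ger0_norm.
Qed.

(** Pointwise the layer is 1-Lipschitz in [c], so its integral is Lipschitz with constant [mu E]. *)
Let continuous_layer (D : X -> R) (p : R) : 0 <= p -> measurable_fun setT D ->
  continuous (fun c => \int[mu]_(x in E) layer D p c x).
Proof.
move=> p0 mD c; apply/cvgrPdist_le => /= eps eps0.
(* Adding 1 keeps the divisor positive even if [mu E = 0]. *)
pose m := fine (mu E) + 1.
have m0 : 0 < m by rewrite ltr_wpDl// fine_ge0.
near=> b.
have bc : `|b - c| <= eps / m.
  near: b; apply: cvgr_distC_le; last exact: divr_gt0. exact: cvg_id.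
rewrite -RintegralB//; try exact: integrable_layer.
have il : mu.-integrable E (EFin \o (fun x => layer D p c x - layer D p b x)).
  have := integrableB mE (integrable_layer D p c p0 mD)
    (integrable_layer D p b p0 mD).
  by apply: eq_integrable => // x _ /=; rewrite EFinB.
apply: (le_trans (le_normr_Rintegral mE il)).
apply: (@le_trans _ _ (\int[mu]_(x in E) `|b - c|)).
  apply: le_Rintegral => //.
  - exact: (integrable_abse il).
  - by apply: (bounded_integrable _ _ mE _ `|b - c|) => // x _; rewrite normr_id.
  - by move=> x _ /=; rewrite ler_norml /layer; have := ler_norml (b - c) `|b - c|; rewrite lexx => /esym; minmax_lra.
rewrite Rintegral_cst//.
apply: (@le_trans _ _ (eps / m * m)); last by rewrite divfK// gt_eqF.
apply: ler_pM => //.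
by rewrite lerDl.
Unshelve. all: by end_near.
Qed.

Let exists_layer (D : X -> R) (p e M : R) : 0 <= p -> 0 <= e -> measurable_fun setT D ->
  (forall x, 0 <= D x <= M) ->
  exists c, [/\ 0 <= c, \int[mu]_(x in E) layer D p c x <= e &
    0 < c -> \int[mu]_(x in E) layer D p c x = e].
Proof.
move=> p0 e0 mD DM.
have [I0|I0] := leP (\int[mu]_(x in E) layer D p 0 x) e.
  by exists 0; split => //; rewrite ltxx.
have M0 : 0 <= M by have := DM point; lra.
(* As [D <= M], nothing lies above height [M]; the intermediate value theorem applies between
   heights 0 and [M]. *)
have IM : \int[mu]_(x in E) layer D p M x = 0.
  rewrite (@eq_Rintegral _ _ _ mu E (fun=> 0)) ?Rintegral_cst ?mul0r//.
  by move=> x _ /=; have := DM x; rewrite /layer; minmax_lra.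
have [||c] := @IVT R (fun c => \int[mu]_(x in E) layer D p c x) 0 M e M0.
- exact/continuous_subspaceT/continuous_layer.
- by rewrite IM ge_min le_max e0 orbT (ltW I0).
by rewrite in_itv/= => /andP[c0 _] Ie; exists c; split; rewrite ?Ie.
Qed.

(** The bound by [D] is stated at every point because a policy may never exceed the demand; equality
    is required only almost everywhere. *)
Lemma allocation (I : eqType) (P e : I -> R) (s : seq I) (M : R) (D : X -> R) :
  (forall i, 0 <= P i) -> (forall i, 0 <= e i) -> uniq s ->
  measurable_fun setT D -> (forall x, 0 <= D x <= M) ->
  (forall A : pred I,
    \int[mu]_(x in E) Num.max (D x - \sum_(i <- s | A i) P i) 0 <=
    \sum_(i <- s | ~~ A i) e i) ->
  exists q : I -> X -> R,
    [/\ forall i, measurable_fun setT (q i),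
        forall i x, 0 <= q i x <= P i,
        forall x, \sum_(i <- s) q i x <= D x,
        {ae mu, forall x, E x -> \sum_(i <- s) q i x = D x} &
        forall i, i \in s -> \int[mu]_(x in E) q i x <= e i].
Proof.
move=> P0 e0; elim: s D => [|k s IH] D /=.
  move=> _ mD DM DA; exists (fun _ _ => 0); split => //.
  - by move=> i x; rewrite lexx P0.
  - by move=> x; rewrite big_nil; case/andP: (DM x).
  - have : {ae mu, forall x, E x -> D x = 0}.
      apply: Rintegral0_ae => //.
      + apply: (bounded_integrable _ _ mE _ M) => //; first exact: measurable_funTS.
        by move=> x _; have := DM x => ?; rewrite ger0_norm; lra.
      + by move=> x _; case/andP: (DM x).
      (* With no store left, the condition says that [D] has integral at most 0. *)
      + have := DA xpredT; rewrite !big_nil; apply: le_trans.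
        rewrite le_eqVlt; apply/orP; left; apply/eqP.
        by apply: eq_Rintegral => x _ /=; have := DM x; minmax_lra.
    by apply: filterS => x /[apply] ->; rewrite big_nil.
move=> /andP[ks us] mD DM DA.
have [c [c0 Ie Ice]] := exists_layer D (P k) (e k) M (P0 k) (e0 k) mD DM.
pose q0 := layer D (P k) c; pose D' x := D x - q0 x.
have mq0 : measurable_fun setT q0 by exact: measurable_layer.
have mD' : measurable_fun setT D' by exact: measurable_funB.
have D'M x : 0 <= D' x <= M.
  by rewrite /D' /q0 /layer; have := DM x; have := P0 k; minmax_lra.
have [] := IH D' us mD' D'M.
  move=> A; set PA := \sum_(i <- s | A i) P i.
  have PA0 : 0 <= PA by exact: sumr_ge0.
  (* Since [k] is not in [s], putting [k] into [A] or removing it leaves the sums over [s]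
     unchanged. *)
  have sumE (b : bool) (F : I -> R) :
      \sum_(i <- s | if i == k then b else A i) F i = \sum_(i <- s | A i) F i /\
      \sum_(i <- s | ~~ (if i == k then b else A i)) F i =
        \sum_(i <- s | ~~ A i) F i.
    split; rewrite big_seq_cond [RHS]big_seq_cond; apply: eq_bigl => i;
      by apply: andb_id2l => is_; case: eqVneq => // ik; rewrite -ik is_ in ks.
  have imax a (F : X -> R) : measurable_fun setT F -> (forall x, 0 <= F x <= M) -> 0 <= a ->
      mu.-integrable E (EFin \o (fun x => Num.max (F x - a) 0)).
    move=> mF FM a0; apply: (bounded_integrable _ _ mE _ M) => //.
      apply: measurable_funTS; apply: measurable_maxr => //.
      exact: measurable_funB.
    by move=> x _; have := FM x; rewrite ler_norml; minmax_lra.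
  (* If [c <= PA], the excess of [D'] over [PA] is pointwise that of [D] over [P k + PA]: wherever
     the layer is not full, [D' <= c] and both vanish. *)
  have [cPA|PAc] := leP c PA.
    have := DA (fun i => if i == k then true else A i).
    rewrite !big_cons eqxx /= (sumE true P).1 (sumE true e).2 -/PA.
    apply: le_trans.
    rewrite le_eqVlt; apply/orP; left; apply/eqP.
    apply: eq_Rintegral => x _ /=.
    by rewrite /D' /q0 /layer; have := DM x; have := P0 k; minmax_lra.
  have := DA (fun i => if i == k then false else A i).
  rewrite !big_cons eqxx /= (sumE false P).1 (sumE false e).2 -/PA.
  (* Now [c > PA >= 0], so the layer uses exactly [e k]. It lies wholly above [PA], so removing it
     lowers the excess over [PA] by exactly [q0]. *)
  rewrite -[X in X + _]Ice ?(le_lt_trans PA0)// -/q0 -lerBlDl.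
  rewrite -RintegralB//; [|exact: imax|exact: integrable_layer].
  apply: le_trans.
  rewrite le_eqVlt; apply/orP; left; apply/eqP.
  apply: eq_Rintegral => x _ /=.
  by rewrite /D' /q0 /layer; have := DM x; have := P0 k; minmax_lra.
move=> q [mq qP qD qae qe].
have sumq x : \sum_(i <- s) (if i == k then q0 x else q i x) = \sum_(i <- s) q i x.
  apply: eq_big_seq => i is_; case: eqVneq => // ik; by rewrite -ik is_ in ks.
exists (fun i => if i == k then q0 else q i); split.
- by move=> i; case: ifP.
- by move=> i x; case: eqVneq => [->|_]; [exact: layer_itv|exact: qP].
- move=> x; rewrite big_cons eqxx.
  under eq_bigr => i do rewrite (fun_if (fun f => f x)).
  by rewrite sumq; have := qD x; rewrite /D'; lra.
- apply: filterS qae => x /[apply]; rewrite big_cons eqxx.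
  under [in X in _ -> X]eq_bigr => i do rewrite (fun_if (fun f => f x)).
  by rewrite sumq /D'; lra.
- by move=> i; rewrite inE; case: eqVneq => [-> _|_ /qe].
Qed.

End Allocation.

(** * Necessity: excess demand under a cross-charging policy *)

Lemma nondecreasing_threshold (R : realType) (d : R -> R) (T c : R) :
  0 <= T -> (forall s t, 0 <= s -> s <= t -> t <= T -> d s <= d t) ->
  exists tau, [/\ 0 <= tau <= T, forall t, 0 <= t < tau -> d t <= c &
    forall t, tau < t <= T -> c < d t].
Proof.
(* Adjoining 0 keeps the set nonempty, with supremum 0, when [d] exceeds [c] on all of [[0, T]]. *)
move=> T0 dm; pose A := [set t | t = 0 \/ 0 <= t <= T /\ d t <= c].
have A0 : A 0 by left.
have ubA : ubound A T by move=> t [->|[/andP[]]].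
have hA : has_sup A by split; [exists 0 | exists T].
have sup0 : 0 <= sup A by apply: ub_le_sup => //; exists T.
have supT : sup A <= T by apply: ge_sup => //; exists 0.
exists (sup A); split; first by rewrite sup0.
  move=> t /andP[t0 tA]; have [||s] := @sup_gt _ A t; [by exists 0|by []|].
  case=> [-> /(le_lt_trans t0)|[/andP[s0 sT] dsc] ts]; first by rewrite ltxx.
  by rewrite (le_trans _ dsc)// dm// ltW.
move=> t /andP[At tT]; rewrite ltNge; apply/negP => dtc.
have : t <= sup A.
  apply: ub_le_sup; first by exists T.
  by right; rewrite (le_trans sup0 (ltW At)) tT.
by rewrite leNgt At.
Qed.

Section CrossCharging.
Context {R : realType} {S : finType}.
Variables (Ebar P P' eta : S -> R) (T : R) (d : R -> R) (r : S -> R -> R).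
Hypotheses (hP : forall i, 0 < P i) (hP' : forall i, 0 <= P' i) (heta : forall i, 0 < eta i <= 1).
Hypothesis hT : 0 < T.
Hypothesis hdmono : forall s t, 0 <= s -> s <= t -> t <= T -> d s <= d t.
Hypothesis hdint : (@lebesgue_measure R).-integrable `[0, T] (EFin \o d).
Hypotheses (hr : is_policy Ebar P P' eta T d Ebar r)
  (hserve : completely_serves eta T d r).

Local Notation mu := (@lebesgue_measure R).

Lemma policy_integrable i : mu.-integrable `[0, T] (EFin \o r i).
Proof.
have [mr hr'] := hr.
apply: (@bounded_integrable _ _ _ _ _ _ _ (P i + P' i)) => //.
- by rewrite /= lebesgue_measure_itv/=; case: ifP => _; rewrite ?ltry.
- exact: (measurable_funTS (mr i)).
- move=> t; rewrite /= in_itv/= => /hr'[_ [/(_ i) + _]].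
  by have := hP i; have := hP' i; rewrite ler_norml; lra.
Qed.

(** As [eta i <= 1], a negative rate satisfies [r i t / eta i <= r i t]; a charging store in [A] is
    bounded by 0 instead. *)
Lemma served_le_sum (A : pred S) t :
  served eta r t <= \sum_(i | A i) Num.max (r i t) 0 + \sum_(i | ~~ A i) r i t.
Proof.
rewrite /served (bigID A)/=; apply: lerD; apply: ler_sum => i _; case: ifPn.
- by rewrite le_max lexx.
- rewrite -ltNge => ri; rewrite le_max; apply/orP; right.
  by have /andP[? _] := heta i; rewrite pmulr_lle0 ?invr_gt0// ltW.
- by [].
- rewrite -ltNge => ri; have /andP[e0 e1] := heta i.
  by rewrite ler_pdivrMr// ler_nMr.
Qed.

Lemma excess_demand_le (A : pred S) :
  \int[mu]_(t in `[0, T]) Num.max (d t - \sum_(i | A i) P i) 0 <=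
  \sum_(i | ~~ A i) \int[mu]_(t in `[0, T]) r i t.
Proof.
set c := \sum_(i | A i) P i; set f := fun t => Num.max (d t - c) 0.
have [mr hr'] := hr; have T0 := ltW hT.
have [tau [/andP[tau0 tauT] ltau gtau]] := nondecreasing_threshold _ d T c T0 hdmono.
have c0 : 0 <= c by apply: sumr_ge0 => i _; exact: ltW.
have md : measurable_fun `[0, T] d by apply/measurable_EFinP; case/integrableP : hdint.
have fi : mu.-integrable `[0, T] (EFin \o f).
  apply: le_normr_integrable hdint _ => //.
    apply: measurable_maxr => //; exact: measurable_funB.
  move=> t _; rewrite /f ger0_norm ?le_max ?lexx ?orbT// ge_max normr_ge0 andbT.
  by rewrite (le_trans _ (ler_norm _))// gerBl.
have sub2 : `]tau, T] `<=` `[0, T].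
  by move=> t; rewrite /= !in_itv/= => /andP[taut ->]; rewrite ltW// (le_lt_trans tau0).
have sub1 : `[0, tau[ `<=` `[0, T].
  move=> t; rewrite /= !in_itv/= => /andP[-> /ltW]/= ttau; exact: le_trans ttau tauT.
have f0 : \int[mu]_(t in `[0, tau]) f t = 0.
  (* The point [tau], where [d] may exceed [c], is dropped as a null set. *)
  rewrite -Rintegral_itv_bndo_bndc; last exact: integrableS fi.
  transitivity (\int[mu]_(t in `[0, tau[) (0 : R)); last first.
    by rewrite Rintegral_cst ?mul0r.
  apply: eq_Rintegral => t; rewrite inE/= in_itv/= => /ltau dc.
  by apply: max_r; rewrite subr_le0.
have -> : \int[mu]_(t in `[0, T]) f t = \int[mu]_(t in `]tau, T]) f t.
  by rewrite -(Rintegral_itvB fi) ?bnd_simp// f0 subr0.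
apply: (@le_trans _ _ (\int[mu]_(t in `]tau, T]) \sum_(i | ~~ A i) r i t)).
  apply: ae_le_Rintegral => //.
  - exact: integrableS fi.
  - apply: integrable_sum_EFin => // i; exact: integrableS (policy_integrable i).
  - move: hserve; apply: filterS; first exact: (ae_filter_ringOfSetsType mu).
    move=> t srv; rewrite /= in_itv/= => /andP[taut tT].
    have t0 : 0 <= t by rewrite (le_trans tau0)// ltW.
    have cd := gtau t; rewrite taut tT in cd; have {}cd := cd isT.
    (* After [tau] the excess is [d t - c], and the stores in [A] supply at most [c] of the
       demand. *)
    rewrite /f max_l ?subr_ge0 1?[_ <= d t]ltW// -srv ?t0// lerBlDl.
    apply: (le_trans (served_le_sum A t)); rewrite lerD2r.
    apply: ler_sum => i _; rewrite ge_max (ltW (hP i)) andbT.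
    by have [|_ [/(_ i)/andP[]]] := hr' t; rewrite ?t0.
rewrite Rintegral_sum//; last by move=> i; exact: integrableS (policy_integrable i).
apply: ler_sum => i _.
rewrite -(Rintegral_itvB (policy_integrable i)) ?bnd_simp//.
(* The only use of the stores being full at time 0. *)
have [|/(_ i)/andP[_ +] _] := hr' tau; first by rewrite tau0.
by rewrite /level gerBl gerBl.
Qed.

End CrossCharging.

Theorem theorem3 (R : realType) (S : finType) (Ebar P P' eta : S -> R)
  (T : R) (d : R -> R) (r : S -> R -> R)
  (hEbar : forall i, 0 < Ebar i) (hP : forall i, 0 < P i)
  (hP' : forall i, 0 <= P' i) (heta : forall i, 0 < eta i <= 1)
  (hT : 0 < T)
  (hd0 : forall t, 0 <= t <= T -> 0 <= d t)
  (hdint : (@lebesgue_measure R).-integrable `[0%R, T] (EFin \o d))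
  (hdmono : forall s t, 0 <= s -> s <= t -> t <= T -> d s <= d t)
  (hr : is_policy Ebar P P' eta T d Ebar r)
  (hserve : completely_serves eta T d r) :
  exists rh : S -> R -> R,
    is_policy Ebar P P' eta T d Ebar rh /\
    (forall i t, 0 <= t <= T -> 0 <= rh i t) /\
    completely_serves eta T d rh /\
    (forall i, level (Ebar i) (r i) T <= level (Ebar i) (rh i) T).
Proof.
have T0 := ltW hT; have [mr hr'] := hr.
(* Extending [d] by 0 makes it measurable and bounded by [d T] on the whole line, as [allocation]
   requires. *)
pose mu := @lebesgue_measure R; pose D := d \_ `[0, T].
have DE t : 0 <= t <= T -> D t = d t.
  by move=> tT; rewrite /D patchE mem_set//= in_itv.
have D0 t : 0 <= D t <= d T.
  rewrite /D patchE; case: ifPn => [|_]; last by rewrite lexx hd0// lexx T0.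
  by rewrite inE/= in_itv/= => /andP[t0 tT]; rewrite hd0 ?t0// hdmono.
have mD : measurable_fun setT D.
  apply/(@measurable_restrictT _ _ _ R `[0%R, T]%classic d) => //.
  by case/integrableP : hdint => /measurable_EFinP.
have muT : (mu `[0%R, T]%classic < +oo)%E.
  by rewrite /mu lebesgue_measure_itv/=; case: ifP => _; rewrite ?ltry.
have levelT i : 0 <= level (Ebar i) (r i) T <= Ebar i.
  by have [|->] := hr' T; rewrite ?lexx ?T0.
pose e i := \int[mu]_(t in `[0, T]) r i t.
have e0 i : 0 <= e i.
  by have /andP[_] := levelT i; rewrite /level gerBl.
have [|q [mq qP qD qae qe]] := @allocation _ _ R mu `[0, T]%classic (measurable_itv _) muT S P e
    (index_enum S) (d T) D (fun i => ltW (hP i)) e0 (index_enum_uniq S) mD D0.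
  move=> A; have := excess_demand_le _ _ _ _ _ _ _ hP hP' heta hT hdmono hdint hr hserve A.
  apply: le_trans; rewrite le_eqVlt; apply/orP; left; apply/eqP.
  by apply: eq_Rintegral => t; rewrite inE/= in_itv/= => /DE ->.
have qi i : mu.-integrable `[0, T] (EFin \o q i).
  apply: (@bounded_integrable _ _ _ _ _ _ _ (P i)) => //.
    exact: (measurable_funTS (mq i)).
  by move=> t _; have /andP[? ?] := qP i t; rewrite ger0_norm.
have servedq t : served eta q t = \sum_i q i t.
  by apply: eq_bigr => i _; have /andP[->] := qP i t.
have qT i : level (Ebar i) (r i) T <= level (Ebar i) (q i) T.
  by rewrite lerD2l lerN2 qe ?mem_index_enum.
exists q; split; [split => // t tT; split|split; [|split]] => //.
- move=> i; have t0 : 0 <= t by case/andP: tT.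
  rewrite [X in _ && X]gerBl Rintegral_ge0 ?andbT; last first.
    by move=> x _; case/andP: (qP i x).
  (* Without charging, levels only fall, so the level at [t] is at least the final one, which is at
     least the nonnegative final level under [r]. *)
  have /andP[+ _] := levelT i; move/le_trans; apply.
  apply: (le_trans (qT i)); rewrite lerD2l lerN2 -subr_ge0.
  rewrite Rintegral_itvB ?bnd_simp//; last by case/andP: tT.
  by apply: Rintegral_ge0 => x _; case/andP: (qP i x).
- split.
    by move=> i; have := qP i t; have := hP' i; lra.
  rewrite servedq -DE// qD sumr_ge0// => i _.
  by case/andP: (qP i t).
- by move=> i t _; case/andP: (qP i t).
- apply: filterS qae.
  by move=> t qt tT; rewrite servedq -DE// qt//= in_itv.
Qed.
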